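(* A graph $G$ is split if and only if $G$ is almost CIS or $G$ is $\cap$-edge simplicial.
   Context: A graph $G=(V,E)$ is split if $V$ can be partitioned into a clique and a stable set. $G$ is almost CIS if every maximal clique $C$ and every maximal stable set $S$ of $G$ intersect, except for exactly one pair $(C_0,S_0)$. A clique $C$ is simplicial if $C=N[v]$ (closed neighborhood) for some vertex $v$. $G$ is edge simplicial if every edge lies in a simplicial clique; $G$ is $\cap$-edge simplicial if both $G$ and its complement $\overline G$ are edge simplicial. *)

(* Defs.v *)
From mathcomp Require Import all_boot.
Set Implicit Arguments. Unset Strict Implicit. Unset Printing Implicit Defensive.

(* A finite simple graph: vertex type T (finType), adjacency e : rel T,
   assumed symmetric and irreflexive (hypotheses of the theorem). *)

Section Graphs.
Variables (T : finType) (e : rel T).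

Definition is_clique (A : {set T}) : bool :=
  [forall x in A, forall y in A, (x != y) ==> e x y].

Definition is_stable (A : {set T}) : bool :=
  [forall x in A, forall y in A, ~~ e x y].

Definition maximal_clique (A : {set T}) : bool := maxset is_clique A.
Definition maximal_stable (A : {set T}) : bool := maxset is_stable A.

Definition split_graph : Prop :=
  exists K S : {set T},
    [/\ is_clique K, is_stable S, K :|: S = setT & K :&: S = set0].

Definition almost_CIS : Prop :=
  exists C0 S0 : {set T},
    [/\ maximal_clique C0, maximal_stable S0, C0 :&: S0 = set0 &
        forall C S : {set T}, maximal_clique C -> maximal_stable S ->
          C :&: S = set0 -> C = C0 /\ S = S0].

Definition closed_nbhd (v : T) : {set T} := [set u | (u == v) || e v u].

Definition simplicial_clique (C : {set T}) : Prop :=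
  is_clique C /\ exists v, C = closed_nbhd v.

Definition edge_simplicial : Prop :=
  forall u v : T, e u v ->
    exists C : {set T}, simplicial_clique C /\ u \in C /\ v \in C.

End Graphs.

Definition compl_rel (T : finType) (e : rel T) : rel T :=
  fun x y => (x != y) && ~~ e x y.

Definition cap_edge_simplicial (T : finType) (e : rel T) : Prop :=
  edge_simplicial e /\ edge_simplicial (compl_rel e).

(* Main.v *)
Require Import Defs.
From mathcomp Require Import all_boot.
Set Implicit Arguments. Unset Strict Implicit. Unset Printing Implicit Defensive.

(* A vertex v fills a clique K and a stable set I if it is equal or adjacent to
   every vertex of K and to no vertex of I; thus (K, I) extends to a disjoint
   pair of maximal sets exactly when nothing fills it.  A split partition that
   nothing fills is the only disjoint maximal pair; one that is filled by v makes
   v simplicial in the graph and in its complement, hence both edge simplicial.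

   If the graph and its complement are edge simplicial, every vertex is
   simplicial in one of them.  A vertex simplicial in both splits the graph;
   otherwise the vertices simplicial in the graph form a stable set, and dually
   the others form a clique.

   If (C, S) is the only disjoint maximal pair, let R be the vertices outside
   C and S, and suppose R is not empty.  Every unfilled pair lies inside (C, S).
   Choosing x in R with N_S(x) minimal gives c in C - N(x) with
   N_S(c) = N_S(x); choosing then y in R with N_C(y) maximal and containing c
   gives s in S with s ~ y and N_C(s) = N_C(y).  Induction applied to N(c) and to
   the non-neighbours of s yields e in C and f in S with N_S(e), N_S(c) disjoint
   and N_C(f), N_C(s) covering C.  Let L be a maximal clique among the w in R
   with w ~ s, N_C(w) containing N_C(s), and w adjacent to neither x nor e.  A
   vertex x2 filling (L + f, (S - N(e)) + e) is adjacent to all of L, and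
   ({s} + N_C(s) + L, {x, x2, e}) is filled by nothing although s is not in C. *)

(** * Unfilled pairs *)

Section Fillers.
Variable T : finType.
Implicit Types (a b : rel T) (U C S K I L : {set T}).

(* Adjacency a and non-adjacency b of distinct vertices: every statement below has
   a dual, obtained by swapping a with b and C with S. *)
Definition antipodal a b :=
  [/\ symmetric a, symmetric b, irreflexive a, irreflexive b &
      forall x y, x != y -> a x y = ~~ b x y].

Definition avoids b K := forall x y, x \in K -> y \in K -> ~~ b x y.

Definition fills a b K I v :=
  (forall k, k \in K -> ~~ b k v) /\ (forall i, i \in I -> ~~ a i v).

(* Relative to the vertices in U, so that one can induct on subgraphs. *)
Definition lone_pair a b U C S :=
  [/\ C \subset U /\ S \subset U, avoids b C, avoids a S,
      forall v, v \in U -> ~ fills a b C S v &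
      forall K I, K \subset U -> I \subset U -> avoids b K -> avoids a I ->
        (forall v, v \in U -> ~ fills a b K I v) ->
        K \subset C /\ I \subset S].

Definition nb a S x := [set s in S | a x s].

Lemma antipodalC a b : antipodal a b -> antipodal b a.
Proof.
by case=> sa sb ia ib ab; split=> // x y /ab ->; rewrite negbK.
Qed.

Lemma fillsC a b K I v : fills a b K I v -> fills b a I K v.
Proof. by case. Qed.

Lemma lone_pairC a b U C S : lone_pair a b U C S -> lone_pair b a U S C.
Proof.
case=> [[sC sS] cC cS nf un]; split=> // [v vU /fillsC|K I sK sI cK cI nfKI].
  exact: nf.
by case: (un I K) => // v vU /fillsC; apply: nfKI.
Qed.

Lemma avoidsU1 b x K : symmetric b -> irreflexive b -> avoids b K ->
  (forall k, k \in K -> ~~ b k x) -> avoids b (x |: K).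
Proof.
move=> sb ib cK Kx u v /setU1P[->|uK] /setU1P[->|vK]; rewrite ?ib //.
- by rewrite sb Kx.
- exact: Kx.
- exact: cK.
Qed.

Lemma fillsP a b U K I :
  (exists2 v, v \in U & fills a b K I v) \/
  (forall v, v \in U -> ~ fills a b K I v).
Proof.
case: (boolP [exists v in U, [forall k in K, ~~ b k v] &&
                             [forall i in I, ~~ a i v]]).
  by case/exists_inP=> v vU /andP[/forall_inP Kv /forall_inP Iv]; left; exists v.
move/exists_inPn=> nf; right=> v vU [Kv Iv]; move/negP: (nf v vU); apply.
by apply/andP; split; apply/forall_inP.
Qed.

(** * Maximality inside a lone pair *)

Section LonePair.
Variables (a b : rel T) (U C S : {set T}).
Hypothesis ab : antipodal a b.
Hypothesis lp : lone_pair a b U C S.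
Let R := U :\: (C :|: S).

Lemma outsideP x : reflect [/\ x \in U, x \notin C & x \notin S] (x \in R).
Proof.
rewrite !inE negb_or -andbA.
by apply: (iffP and3P); case=> ? ? ?; split.
Qed.

Lemma lone_pair_disjoint v : v \in C -> v \in S -> False.
Proof.
case: lp => [[/subsetP sC _] cC cS nf _] vC vS; apply: (nf v (sC _ vC)).
by split=> u uK; [apply: cC | apply: cS].
Qed.

(** Enlarging [C] by [v] creates no new filler, so [(v |: C, S)] is still unfilled and must lie
    inside [(C, S)]. *)
Lemma lone_pair_max v : v \in U -> (forall c, c \in C -> ~~ b c v) -> v \in C.
Proof.
case: ab lp => sa sb ia ib _ [[sC sS] cC cS nf un] vU Cv.
have [] := un (v |: C) S.
- by rewrite subUset sub1set vU.
- by [].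
- exact: avoidsU1.
- by [].
- move=> w wU [Kw Iw]; apply: (nf w wU); split=> // k kC.
  by apply: Kw; rewrite setU1r.
- by move/subsetP/(_ v (setU11 _ _)).
Qed.

Lemma filler K I x : K \subset U -> I \subset U -> avoids b K -> avoids a I ->
  x \in K -> x \notin C -> exists2 v, v \in U & fills a b K I v.
Proof.
case: lp => [_ _ _ _ un] sK sI cK cI xK xC.
case: (fillsP a b U K I) => // nf.
by have [/subsetP/(_ x xK)] := un K I sK sI cK cI nf; rewrite (negPf xC).
Qed.

End LonePair.

(** * Vertices outside a lone pair *)

Section Outside.
Variables (a b : rel T) (U C S : {set T}).
Hypothesis ab : antipodal a b.
Hypothesis lp : lone_pair a b U C S.
Let R := U :\: (C :|: S).

Lemma lone_pair_nb c : c \in C -> exists2 s, s \in S & a c s.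
Proof.
move=> cC; case: (boolP [exists s in S, a c s]) => [/exists_inP //|].
move/exists_inPn=> Sc; exfalso; apply: (lone_pair_disjoint lp cC).
apply: (lone_pair_max (antipodalC ab) (lone_pairC lp)).
  by case: lp => [[/subsetP sC _] _ _ _ _]; apply: sC.
by case: ab => sa _ _ _ _ s /Sc; rewrite sa.
Qed.

(** The pair [(K, S)] is not inside [(C, S)], so it has a filler; by maximality of [S] that filler
    lies in [S]. *)
Lemma clique_hit K x : K \subset U -> avoids b K -> x \in K -> x \notin C ->
  exists2 s, s \in S & forall k, k \in K -> ~~ b k s.
Proof.
case: (lp) => [[sC sS] cC cS _ _] sK cK xK xC.
have [v vU [Kv Sv]] := filler lp sK sS cK cS xK xC.
by exists v => //; apply: (lone_pair_max (antipodalC ab) (lone_pairC lp)).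
Qed.

Lemma edge_hit x y : x \in R -> y \in U -> ~~ b x y -> y \notin S ->
  exists2 s, s \in S & a x s && a y s.
Proof.
case: (ab) => sa sb ia ib dab /outsideP[xU xC xS] yU bxy yS.
have [||||s sS Ks] := @clique_hit [set x; y] x.
- by rewrite subUset !sub1set xU.
- by move=> u v /set2P[]-> /set2P[]->; rewrite ?ib // sb.
- by rewrite set21.
- by [].
exists s => //; rewrite !dab ?Ks ?set21 ?set22 //.
- by apply: contraNneq yS => ->.
- by apply: contraNneq xS => ->.
Qed.

Lemma dominating x : x \in R ->
  exists2 s, s \in S & a x s /\ nb b C s \subset nb b C x.
Proof.
case: (ab) (lp) => sa sb ia ib dab [[sC sS] cC cS _ _] /outsideP[xU xC xS].
have [||||s sS' Ks] := @clique_hit (x |: [set c in C | ~~ b x c]) x.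
- rewrite subUset sub1set xU; apply/subsetP=> c; rewrite inE => /andP[cC' _].
  exact: (subsetP sC).
- apply: avoidsU1 => // [u v|k]; rewrite !inE.
    by case/andP=> uC _ /andP[vC _]; apply: cC.
  by rewrite sb => /andP[].
- by rewrite setU11.
- by [].
exists s => //; split.
  by rewrite dab ?Ks ?setU11 //; apply: contraNneq xS => ->.
apply/subsetP=> c; rewrite !inE => /andP[cC' bsc]; rewrite cC' /=.
by apply: contraLR bsc => bxc; rewrite sb Ks // !inE cC' bxc orbT.
Qed.

(** The vertex [v] fills the pair formed by [t] with [L] and by [c] with its non-neighbours in [S].
    It is adjacent to [t] and not to [c], hence outside [S] and [C]. *)
Lemma shrink L x c t : L \subset R -> avoids b L -> x \in L -> c \in C ->
  (forall l, l \in L -> b l c) -> t \in S -> (forall l, l \in L -> a l t) ->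
  a c t -> exists2 v, v \in R &
    [/\ forall l, l \in L -> ~~ b l v, b v c, a v t & nb a S v \subset nb a S c].
Proof.
case: (ab) (lp) => sa sb ia ib dab [[sC sS] cC cS _ _].
move=> sLR cL xL cC' Lc tS Lt act.
have [xU xC xS] := outsideP _ _ _ _ (subsetP sLR x xL).
have dba u v : u != v -> b u v = ~~ a u v by move/dab->; rewrite negbK.
have [||||||v vU [Kv Iv]] := @filler _ _ _ _ _ lp
  (t |: L) (c |: [set s in S | ~~ a c s]) x.
- rewrite subUset sub1set (subsetP sS) //=.
  by apply/subsetP=> l /(subsetP sLR) /outsideP[].
- rewrite subUset sub1set (subsetP sC) //=.
  by apply/subsetP=> s; rewrite inE => /andP[/(subsetP sS)].
- apply: avoidsU1 => // l lL; rewrite -dab ?Lt //.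
  have [_ _ lS] := outsideP _ _ _ _ (subsetP sLR l lL).
  by apply: contraNneq lS => ->.
- apply: avoidsU1 => // [u v|k]; rewrite !inE.
    by case/andP=> uS _ /andP[vS _]; apply: cS.
  by rewrite sa => /andP[].
- by rewrite setU1r.
- by [].
have vt : v != t by apply: contraTneq act => <-; rewrite Iv ?setU11.
have vc : v != c.
  by apply: contraTneq (Lc x xL) => <-; rewrite Kv ?setU1r.
have avt : a v t by rewrite dab // sb Kv ?setU11.
have bvc : b v c by rewrite dba // sa Iv ?setU11.
exists v; first apply/outsideP.
  split=> //; first by apply: contraL bvc => vC; apply: cC.
  by apply: contraL avt => vS; apply: cS.
split=> //; first by move=> l lL; rewrite Kv ?setU1r.
apply/subsetP=> s; rewrite !inE => /andP[sS' avs]; rewrite sS' /=.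
apply: contraLR avs => acs; rewrite sa Iv //.
by rewrite !inE sS' acs orbT.
Qed.

Lemma minimal_trace x0 : x0 \in R -> exists2 x, x \in R &
  nb a S x \subset nb a S x0 /\
  forall v, v \in R -> nb a S v \subset nb a S x -> nb a S v = nb a S x.
Proof.
move=> x0R; pose P v := (v \in R) && (nb a S v \subset nb a S x0).
have Px0 : P x0 by rewrite /P x0R subxx.
case: (arg_minnP (fun v => #|nb a S v|) Px0) => x /andP[xR sx] mx.
exists x => //; split=> // v vR sv; apply/eqP; rewrite eqEcard sv mx //.
by rewrite /P vR (subset_trans sv).
Qed.
End Outside.

Section Twins.
Variables (a b : rel T) (U C S : {set T}).
Hypothesis ab : antipodal a b.
Hypothesis lp : lone_pair a b U C S.
Let R := U :\: (C :|: S).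

Lemma dominated x : x \in R ->
  exists2 c, c \in C & b x c /\ nb a S c \subset nb a S x.
Proof.
rewrite /R setUC => xR.
exact: (dominating (antipodalC ab) (lone_pairC lp) xR).
Qed.

Lemma trace_drop x c : x \in R -> c \in C -> b x c -> nb a S c \subset nb a S x ->
  exists2 v, v \in R & b v c /\ nb a S v \subset nb a S c.
Proof.
case: (ab) => sa sb ia ib dab xR cC bxc scx.
have [t tS act] := lone_pair_nb ab lp cC.
have axt : a x t.
  by move/subsetP/(_ t): scx; rewrite !inE tS act => /(_ isT).
have [||||||||v vR [_ bvc _ svc]] := @shrink _ _ _ _ _ ab lp [set x] x c t.
- by rewrite sub1set.
- by move=> u v /set1P-> /set1P->; rewrite ib.
- exact: set11.
- by [].
- by move=> l /set1P->.
- by [].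
- by move=> l /set1P->.
- by [].
by exists v.
Qed.

(** For [x] of minimal trace, [trace_drop] yields a trace below that of [c], which is itself below
    that of [x]; minimality makes all three equal. *)
Lemma trace_twin x0 : x0 \in R -> exists x c,
  [/\ x \in R, c \in C, b x c, nb a S c = nb a S x &
      nb a S x \subset nb a S x0].
Proof.
move=> /(minimal_trace a)[x xR [sx mx]]; have [c cC [bxc scx]] := dominated xR.
have [v vR [_ svc]] := trace_drop xR cC bxc scx.
exists x, c; split=> //; apply/eqP; rewrite eqEsubset scx.
by rewrite -(mx v vR (subset_trans svc scx)).
Qed.

End Twins.

(** * Induction on the vertex set *)

Lemma neighbourhood_lone_pair a b U C S c y :
  antipodal a b -> lone_pair a b U C S -> c \in C -> y \in U -> a c y ->
  (forall e, e \in C -> exists2 s, s \in S & a c s && a e s) ->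
  lone_pair a b [set u in U | a c u] (C :\ c) (nb a S c).
Proof.
move=> ab lp cC yU acy meet.
case: (ab) (lp) => sa sb ia ib dab [[sC sS] cC' cS nf un].
split.
- split; apply/subsetP=> u; rewrite !inE.
    case/andP=> uc uC; rewrite (subsetP sC) //= dab 1?eq_sym //.
    exact: cC'.
  by case/andP=> uS ->; rewrite (subsetP sS).
- by move=> u v /setD1P[_ uC] /setD1P[_ vC]; apply: cC'.
- by move=> u v; rewrite !inE => /andP[uS _] /andP[vS _]; apply: cS.
- move=> v; rewrite inE => /andP[vU acv] [Cv Sv].
  (* A filler in N(c) is adjacent to all the rest of [C], so it belongs to [C]; it then shares with
     [c] a neighbour in [S]. *)
  have vC : v \in C.
    apply: (lone_pair_max ab lp vU) => k kC; case: (eqVneq k c) => [->|kc].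
      by rewrite -dab //; apply: contraTneq acv => ->; rewrite ia.
    by apply: Cv; rewrite !inE kc.
  have [s sS' /andP[acs avs]] := meet v vC.
  by move: (Sv s); rewrite !inE sS' acs sa avs => /(_ isT).
move=> K I sK sI cK cI nfKI.
have sKU : c |: K \subset U.
  rewrite subUset sub1set (subsetP sC) //=; apply/subsetP=> k /(subsetP sK).
  by rewrite inE => /andP[].
have sIU : I \subset U by apply/subsetP=> k /(subsetP sI); rewrite inE => /andP[].
have [] := un (c |: K) I sKU sIU _ cI _.
- apply: avoidsU1 => // k /(subsetP sK); rewrite inE => /andP[_ ack].
  rewrite sb -dab //; apply: contraTneq ack => ->; by rewrite ia.
- move=> v vU [Kv Iv]; case: (eqVneq v c) => [vc|vc]; last first.
    apply: (nfKI v); first by rewrite inE vU dab 1?eq_sym // Kv ?setU11.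
    by split=> // k kK; rewrite Kv ?setU1r.
  (* If [c] fills the enlarged pair, [I] is empty because it lies in N(c). Then any vertex of [K]
     fills [(K, I)], or [y] does when [K] is empty too. *)
  have I0 i : i \in I -> False.
    move=> iI; move: (Iv i iI) (subsetP sI i iI).
    by rewrite vc sa inE => /negPf->; rewrite andbF.
  case: (set_0Vmem K) => [K0|[k kK]].
    by apply: (nfKI y); [rewrite inE yU|split=> k; [rewrite K0 inE|move/I0]].
  apply: (nfKI k); first exact: (subsetP sK).
  by split=> [j jK|i /I0//]; apply: cK.
move=> sKC sIS; split; apply/subsetP=> u uK; rewrite !inE.
  rewrite (subsetP sKC) ?setU1r // andbT.
  by apply: contraTneq (subsetP sK u uK) => ->; rewrite inE ia andbF.
by rewrite (subsetP sIS) //; move: (subsetP sI u uK); rewrite inE => /andP[].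
Qed.

(** Both relations are quantified so that the induction hypothesis also serves the complement. *)
Definition covered_below n := forall a b U C S, #|U| < n -> antipodal a b ->
  lone_pair a b U C S -> U \subset C :|: S.

(** Otherwise N(c) carries a lone pair on fewer vertices, and induction would place [y] in [C] or
    [S]. *)
Lemma disjoint_trace n a b U C S c y : covered_below n -> #|U| <= n ->
  antipodal a b -> lone_pair a b U C S -> c \in C -> y \in U :\: (C :|: S) ->
  a c y -> exists2 e, e \in C & forall s, s \in S -> a c s -> ~~ a e s.
Proof.
move=> IH Un ab lp cC yR acy.
case: (boolP [exists e in C, [forall s in S, a c s ==> ~~ a e s]]).
  case/exists_inP=> e eC /forall_inP es; exists e => // s sS acs.
  exact: (implyP (es s sS)).
move/exists_inPn=> meet; exfalso.
have [yU yC yS] := outsideP _ _ _ _ yR.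
case: (ab) (lp) => sa sb ia ib dab [[sC sS] cC' cS nf un].
have lp' : lone_pair a b [set u in U | a c u] (C :\ c) (nb a S c).
  apply: (neighbourhood_lone_pair ab lp cC yU acy) => e eC.
  have /forall_inPn[s sS' ] := meet e eC.
  by rewrite negb_imply negbK => ?; exists s.
have lt : #|[set u in U | a c u]| < n.
  apply: leq_trans Un; apply: proper_card; apply/properP; split.
    by apply/subsetP=> u; rewrite inE => /andP[].
  by exists c; rewrite ?(subsetP sC) // inE ia andbF.
have /subsetP/(_ y) := IH _ _ _ _ _ lt ab lp'.
by rewrite !inE yU acy (negPf yC) (negPf yS) andbF => /(_ isT).
Qed.

Lemma lone_pair_cover n : covered_below n.
Proof.
elim: n => [//|n IH] a b U C S Un ab lp.
apply/subsetP=> x0 x0U; apply/negPn/negP=> x0CS.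
have {x0U x0CS} : x0 \in U :\: (C :|: S) by rewrite inE x0CS.
set R := U :\: (C :|: S).
have ba := antipodalC ab; have lp' := lone_pairC lp.
have RE : U :\: (S :|: C) = R by rewrite setUC.
case: (ab) (lp) => sa sb ia ib dab [[sC sS] cC cS nf un].
have dba u v : u != v -> b u v = ~~ a u v by move/dab->; rewrite negbK.
case/(trace_twin ab lp)=> x [c [xR c_C bxc Qc _]].
have [xU xC xS] := outsideP _ _ _ _ xR.
have Sc t : t \in S -> a c t = a x t.
  by move=> tS; move/setP/(_ t): Qc; rewrite !inE tS.
(* [s1] is adjacent to [x], hence to its twin [c]. Starting the dual descent below the
   non-neighbours of [s1] keeps [c] adjacent to [y] and [s]. *)
have [s1 s1S [axs1 ss1]] := dominating ab lp xR.
have [z zC bs1z] := lone_pair_nb ba lp' s1S.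
have bxz : b x z.
  by move/subsetP/(_ z): ss1; rewrite !inE zC bs1z => /(_ isT).
have [v0 v0R [_ sv0]] : exists2 v, v \in U :\: (S :|: C) &
    a v s1 /\ nb b C v \subset nb b C s1.
  by apply: (trace_drop ba lp' (x := x)); rewrite ?RE.
have [y [s [yR s_S ays Ps sy]]] := trace_twin ba lp' v0R.
rewrite RE in yR; have [yU yC yS] := outsideP _ _ _ _ yR.
have Cs u : u \in C -> b s u = b y u.
  by move=> uC; move/setP/(_ u): Ps; rewrite !inE uC.
have neCS u v : u \in C -> v \in S -> u != v.
  by move=> uC vS; apply: contraTneq uC => ->; apply/negP=> /(lone_pair_disjoint lp); apply.
have acs1 : a c s1 by rewrite Sc.
have bsc : ~~ b s c.
  rewrite Cs //; have := subset_trans sy sv0.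
  move/subsetP/(_ c); rewrite !inE c_C /= => h; apply/negP=> /h.
  by rewrite sb -[b c s1]negbK -dab ?acs1 // neCS.
have acs : a c s by rewrite dab ?neCS // sb.
have axs : a x s by rewrite -Sc.
have acy : a c y.
  by rewrite dab ?(contraNneq _ yC) // => [|<- //]; rewrite sb -Cs.
have [e eC eQ] := disjoint_trace IH Un ab lp c_C yR acy.
have nes : ~~ a e s by apply: eQ.
have bse : b s e by rewrite sb dba ?neCS.
(* If adjacent, [x] and [e] would share a neighbour in [S], which would also be a neighbour of
   [c]. *)
have bxe : b x e.
  apply: contraT => nbxe.
  have [||t tS /andP[axt aet]] := edge_hit ab lp xR _ nbxe.
  - exact: (subsetP sC).
  - by apply/negP=> /(lone_pair_disjoint lp eC).
  by move: (eQ t tS); rewrite Sc // aet => /(_ axt).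
(* The dual of [disjoint_trace] needs a non-neighbour of [s] outside the pair: take a trace inside
   that of [c2], which misses [s]. *)
have [v1 v1R nv1s] : exists2 v, v \in R & b s v.
  have [c2 c2C [byc2 sc2]] := dominated ab lp yR.
  have [v vR [_ svc]] := trace_drop ab lp yR c2C byc2 sc2.
  have [vU vC vS] := outsideP _ _ _ _ vR.
  exists v => //; rewrite dba ?(contraNneq _ vS) // => [|<- //].
  rewrite sa; apply/negP=> avs; move/subsetP/(_ s): svc; rewrite !inE s_S avs.
  move/(_ isT); rewrite dab ?neCS // sb Cs //.
  by rewrite byc2.
have [|f fS fC] := disjoint_trace IH Un ba lp' s_S _ nv1s; first by rewrite RE.
have aef : a e f by rewrite dab ?neCS // sb fC.
pose Y := [set w in R | [&& a w s, b w e, ~~ a x w & nb b C w \subset nb b C s]].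
(* Were [w] and [f] non-adjacent, they would have a common non-neighbour in [C]; [s] misses it as
   well, against the choice of [f]. *)
have Yf w : w \in Y -> a w f.
  rewrite inE => /and5P[wR aws bwe naxw sw]; apply: contraT => nawf.
  have [wU wC wS] := outsideP _ _ _ _ wR.
  have [|||u uC /andP[bwu bfu]] := edge_hit ba lp' _ _ nawf.
  - by rewrite RE.
  - exact: (subsetP sS).
  - by apply/negP=> /(lone_pair_disjoint lp); apply.
  move/subsetP/(_ u): sw; rewrite !inE uC bwu => /(_ isT) bsu.
  by move: (fC u uC bsu); rewrite bfu.
have [y1 y1Y] : exists y1, y1 \in Y.
  have [||||||||w wR [nxw aws bwe sw]] := @shrink _ _ _ _ _ ba lp' [set x] x s e.
  - by rewrite RE sub1set.
  - by move=> u v /set1P-> /set1P->; rewrite ia.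
  - exact: set11.
  - by [].
  - by move=> l /set1P->.
  - by [].
  - by move=> l /set1P->.
  - by [].
  by exists w; rewrite RE in wR; rewrite inE wR aws bwe nxw ?set11.
pose clq L := (L \subset Y) && [forall u in L, forall v in L, ~~ b u v].
have [L /maxsetP[/andP[/subsetP LY /forall_inP Lb] mL]] :
    {L | maxset clq L & [set y1] \subset L}.
  apply: maxset_exists; rewrite /clq sub1set y1Y /=.
  by apply/forall_inP=> u /set1P->; apply/forall_inP=> v /set1P->; rewrite ib.
rewrite sub1set => y1L.
have cL : avoids b L by move=> u v uL vL; apply: (forall_inP (Lb u uL)).
have LYP w : w \in L -> [/\ w \in R, a w s, b w e, ~~ a x w &
    nb b C w \subset nb b C s] by move/LY; rewrite inE => /and5P.
have [||||||||x2 x2R [Lx2 bx2e ax2f sx2]] := @shrink _ _ _ _ _ ab lp L y1 e f => //.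
- by apply/subsetP=> w /LYP[].
- by move=> w /LYP[].
- by move=> w /LY /Yf.
have [x2U x2C x2S] := outsideP _ _ _ _ x2R.
have x2Q t : t \in S -> a x t -> ~~ a x2 t.
  move=> tS axt; apply/negP=> ax2t; move/subsetP/(_ t): sx2.
  by rewrite !inE tS ax2t (negPf (eQ t tS _)) ?Sc // => /(_ isT).
have naxx2 : ~~ a x x2.
  apply/negP=> axx2; have [|||t tS /andP[axt ax2t]] := edge_hit ab lp (y := x2) xR => //.
    by rewrite -dab //; apply: contraTneq axx2 => ->; rewrite ia.
  by move: (x2Q t tS axt); rewrite ax2t.
(* Since [s] is outside [C], this clique with [{x, x2, e}] has a filler [w]. It turns out to lie in
   [Y], hence in [L] by maximality, so [x2] is equal or adjacent to it; yet [w] is not adjacent to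
   [x2], and differs from it by being adjacent to [s]. *)
pose K := s |: ([set u in C | ~~ b s u] :|: L).
have [||||||w wU [Kw Iw]] := @filler _ _ _ _ _ lp K (x |: [set x2; e]) s.
- rewrite !subUset sub1set (subsetP sS) //=; apply/andP; split; apply/subsetP=> u.
    by rewrite inE => /andP[/(subsetP sC)].
  by case/LYP=> /outsideP[].
- by rewrite !subUset !sub1set xU x2U (subsetP sC).
- apply: avoidsU1 => // [u v|u].
    case/setUP; [rewrite inE => /andP[uC su]|move=> uL];
      (case/setUP; [rewrite inE => /andP[vC sv]|move=> vL]); first exact: cC.
    + have [_ _ _ _ /subsetP/(_ u)] := LYP v vL; rewrite !inE uC /= sb => h.
      by apply: contra su => /h.
    + have [_ _ _ _ /subsetP/(_ v)] := LYP u uL; rewrite !inE vC /= => h.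
      by apply: contra sv => /h.
    + exact: cL.
  case/setUP; first by rewrite inE sb => /andP[].
  by case/LYP=> _ aus _ _ _; rewrite -dab //; apply: contraTneq aus => ->; rewrite ia.
- have bneg u v : b u v -> ~~ a u v.
    by move=> buv; rewrite -dba //; apply: contraTneq buv => ->; rewrite ib.
  apply: avoidsU1 => // [u v|u]; last first.
    by case/set2P=> ->; rewrite sa // bneg.
  by case/set2P=> -> /set2P[]->; rewrite ?ia // ?(sa e) bneg.
- by rewrite setU11.
- by apply/negP=> /(lone_pair_disjoint lp); apply.
have nexw : ~~ a x w by rewrite Iw ?setU11.
have ws : w != s by apply: contraNneq nexw => ->.
have we : w != e.
  by apply: contraTneq bse => <-; rewrite Kw ?setU11.
have aws : a w s by rewrite dab // sb Kw ?setU11.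
have bwe : b w e by rewrite dba // sa Iw // !inE eqxx !orbT.
have wR : w \in R.
  apply/outsideP; split=> //; first by apply: contraL bwe => wC; apply: cC.
  by apply: contraL aws => wS; apply: cS.
have wY : w \in Y.
  rewrite inE wR aws bwe nexw; apply/subsetP=> u; rewrite !inE => /andP[uC].
  by rewrite uC /=; apply: contraLR => bsu; rewrite sb Kw // !inE uC bsu orbT.
have wL : w \in L.
  rewrite -(mL (w |: L)) ?setU11 ?subsetUr //; apply/andP; split.
    by rewrite subUset sub1set wY; apply/subsetP.
  have cwL : avoids b (w |: L).
    by apply: avoidsU1 => // l lL; rewrite Kw // !inE lL !orbT.
  by apply/forall_inP=> u uL; apply/forall_inP=> v vL; apply: cwL.
have := Lx2 w wL; rewrite -dab; last first.
  by apply: contraTneq aws => ->; rewrite x2Q.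
by rewrite sa; apply/negP/Iw; rewrite !inE eqxx orbT.
Qed.
End Fillers.

(** * Split graphs *)

Section SplitGraphs.
Variable T : finType.
Implicit Types (a b e : rel T) (K S : {set T}).

Lemma compl_antipodal e :
  symmetric e -> irreflexive e -> antipodal e (compl_rel e).
Proof.
move=> se ie; split=> //.
- by move=> x y; rewrite /compl_rel eq_sym se.
- by move=> x; rewrite /compl_rel eqxx.
- by move=> x y xy; rewrite /compl_rel xy negbK.
Qed.

Lemma is_cliqueP a b K : antipodal a b -> reflect (avoids b K) (is_clique a K).
Proof.
case=> _ _ _ ib dab; apply: (iffP forall_inP) => [cK x y xK yK|cK x xK].
  case: (eqVneq x y) => [->|xy]; first by rewrite ib.
  by rewrite -dab //; apply: (implyP (forall_inP (cK x xK) y yK)).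
by apply/forall_inP=> y yK; apply/implyP=> xy; rewrite dab ?cK.
Qed.

Lemma is_stableP e S : reflect (avoids e S) (is_stable e S).
Proof.
apply: (iffP forall_inP) => [cS x y xS yS|cS x xS].
  exact: (forall_inP (cS x xS)).
by apply/forall_inP=> y yS; apply: cS.
Qed.

(** * Simplicial vertices *)

Lemma in_closed_nbhd a b u v :
  antipodal a b -> (u \in closed_nbhd a v) = ~~ b v u.
Proof.
case=> _ _ _ ib dab; rewrite inE; case: eqVneq => [->|uv]; first by rewrite ib.
by rewrite dab // eq_sym.
Qed.

Definition simplicial b v := forall x y, ~~ b v x -> ~~ b v y -> ~~ b x y.

Lemma simplicialP a b v : antipodal a b ->
  reflect (simplicial b v) (is_clique a (closed_nbhd a v)).
Proof.
move=> ab; apply: (iffP (is_cliqueP _ ab)) => sv x y.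
  by rewrite -!(in_closed_nbhd _ v ab); apply: sv.
by rewrite !(in_closed_nbhd _ _ ab); apply: sv.
Qed.

Lemma edge_simplicialP a b : antipodal a b ->
  edge_simplicial a <->
  forall u v, a u v -> exists w, [/\ simplicial b w, ~~ b w u & ~~ b w v].
Proof.
move=> ab; split=> es u v /es.
  case=> K [[cK [w Kw]]]; rewrite Kw !(in_closed_nbhd _ _ ab) => -[wu wv].
  by exists w; split=> //; apply/(simplicialP _ ab); rewrite -Kw.
case=> w [/(simplicialP _ ab) sw wu wv]; exists (closed_nbhd a w).
by rewrite !(in_closed_nbhd _ _ ab); do !split=> //; exists w.
Qed.

Lemma nbhd_in_clique_simplicial b K v : symmetric b -> avoids b K ->
  (forall x, x != v -> ~~ b v x -> x \in K) -> simplicial b v.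
Proof.
move=> sb cK vK x y vx vy.
case: (eqVneq x v) => [->//|xv]; case: (eqVneq y v) => [->|yv]; first by rewrite sb.
by apply: cK; apply: vK.
Qed.

(** A vertex of [S] has all its neighbours in [K], so it is simplicial and handles the edges it
    meets. The filler [v] also has all its neighbours in [K] and handles the edges inside [K]. *)
Lemma filled_split_edge_simplicial a b K S v : antipodal a b ->
  avoids b K -> avoids a S -> K :|: S = setT -> fills a b K S v ->
  edge_simplicial a.
Proof.
move=> ab cK cS KS [Kv Sv]; apply/(edge_simplicialP ab) => x y axy.
case: (ab) => sa sb ia ib dab.
have inK x0 : x0 \notin S -> x0 \in K.
  by move=> xS; move: (in_setT x0); rewrite -KS inE (negPf xS) orbF.
have sS z : z \in S -> simplicial b z.
  move=> zS; apply: (nbhd_in_clique_simplicial sb cK) => u uz bzu.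
  by apply: inK; apply: contraL bzu => uS; rewrite negbK -[b z u]negbK -dab 1?eq_sym // cS.
have xy : x != y by apply: contraTneq axy => ->; rewrite ia.
have nbxy : ~~ b x y by rewrite -dab.
case: (boolP (x \in S)) => xS; first by exists x; split; rewrite ?ib //; apply: sS.
case: (boolP (y \in S)) => yS.
  by exists y; split; rewrite ?ib // 1?sb //; apply: sS.
exists v; split; rewrite 1?sb; try by apply: Kv; apply: inK.
apply: (nbhd_in_clique_simplicial sb cK) => u uv bvu.
apply: inK; apply: contraL bvu => uS.
by rewrite negbK sb -[b u v]negbK -dab // Sv.
Qed.

(** * Maximal cliques of a split graph *)

Lemma maximal_cliqueP a b K : antipodal a b ->
  reflect (avoids b K /\ forall v, (forall k, k \in K -> ~~ b k v) -> v \in K)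
          (maximal_clique a K).
Proof.
move=> ab; case: (ab) => sa sb ia ib dab; apply: (iffP maxsetP) => -[].
  move=> /(is_cliqueP _ ab) cK mK; split=> // v Kv.
  rewrite -(mK (v |: K)) ?setU11 ?subsetUr //.
  by apply/(is_cliqueP _ ab)/avoidsU1.
move=> cK mK; split=> [|L /(is_cliqueP _ ab) cL KL]; first exact/(is_cliqueP _ ab).
apply/eqP; rewrite eqEsubset KL andbT; apply/subsetP=> v vL.
by apply: mK => k kK; apply: cL => //; apply: (subsetP KL).
Qed.

Lemma maximal_stableE a b S : antipodal a b ->
  maximal_stable a S = maximal_clique b S.
Proof.
move=> ab; apply: maxset_eq => L.
by apply/is_stableP/(is_cliqueP _ (antipodalC ab)).
Qed.

(** [C] must meet [S], or maximality would give [C = K]. For [s] in both, the closed neighbourhood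
    of [s] is a clique containing [C], so maximality puts it inside [C]. *)
Lemma other_maximal_clique a b K S C : antipodal a b ->
  avoids b K -> avoids a S -> K :|: S = setT ->
  maximal_clique a C -> C != K ->
  exists2 s, s \in S & forall x, ~~ b s x -> x \in C.
Proof.
move=> ab cK cS KS /(maximal_cliqueP _ ab)[cC mC] CK.
case: (ab) => sa sb ia ib dab.
have inK x : x \notin S -> x \in K.
  by move=> xS; move: (in_setT x); rewrite -KS inE (negPf xS) orbF.
have [s sC sS] : exists2 s, s \in C & s \in S.
  apply/exists_inP; apply: contraR CK => /exists_inPn nCS; apply/eqP/setP=> x.
  apply/idP/idP=> [/nCS/inK//|xK]; apply: mC => k /nCS /inK kK; exact: cK.
exists s => // x bsx; apply: mC => k kC.
have nbhd u : u != s -> ~~ b s u -> u \in K.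
  move=> us bsu; apply: inK; apply: contraL bsu => uS.
  by rewrite negbK -[b s u]negbK -dab 1?eq_sym // cS.
by apply: (nbhd_in_clique_simplicial sb cK nbhd) => //; apply: cC.
Qed.

Lemma unfilled_split_maximal a b K S : antipodal a b ->
  avoids b K -> avoids a S -> K :|: S = setT ->
  (forall v, ~ fills a b K S v) -> maximal_clique a K.
Proof.
move=> ab cK cS KS nf; apply/(maximal_cliqueP _ ab); split=> // v Kv.
apply: contraT => vK; case: (nf v); split=> // s sS; apply: cS => //.
by move: (in_setT v); rewrite -KS inE (negPf vK).
Qed.

Lemma split_dichotomy e : symmetric e -> irreflexive e ->
  split_graph e -> almost_CIS e \/ cap_edge_simplicial e.
Proof.
move=> se ie [K [S [cK cS KS KS0]]].
have ab := compl_antipodal se ie; have ba := antipodalC ab.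
move/(is_cliqueP _ ab): cK => cK; move/is_stableP: cS => cS.
have SK : S :|: K = setT by rewrite setUC.
case: (fillsP e (compl_rel e) setT K S) => [[v _ fv]|nf]; [right|left].
  split; first exact: (filled_split_edge_simplicial ab cK cS KS fv).
  exact: (filled_split_edge_simplicial ba cS cK SK (fillsC fv)).
have nf1 v : ~ fills e (compl_rel e) K S v by apply: nf.
have nf2 v : ~ fills (compl_rel e) e S K v by move/fillsC; apply: nf1.
exists K, S; split=> //.
- exact: (unfilled_split_maximal ab cK cS KS nf1).
- by rewrite (maximal_stableE _ ab) (unfilled_split_maximal ba cS cK SK nf2).
move=> C I mC; rewrite (maximal_stableE _ ab) => mI CI0.
have disj x : x \in C -> x \in I -> False.
  by move=> xC xI; move/setP/(_ x): CI0; rewrite !inE xC xI.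
case: (ab) => _ _ _ ib dab; case: (eqVneq C K) (eqVneq I S) => [CK|CK] [IS|IS] //.
- have [k kK kI] := other_maximal_clique ba cS cK SK mI IS.
  by case: (disj k); rewrite ?CK ?kI ?ie.
- have [s sS sC] := other_maximal_clique ab cK cS KS mC CK.
  by case: (disj s); rewrite ?IS ?sC ?ib.
- have [k kK kI] := other_maximal_clique ba cS cK SK mI IS.
  have [s sS sC] := other_maximal_clique ab cK cS KS mC CK.
  (* If [k] and [s] are adjacent, [k] lies in both [C] and [I]; otherwise [s] does. *)
  case: (boolP (e k s)) => eks.
    by case: (disj k); rewrite ?kI ?ie // sC // /compl_rel se eks andbF.
  by case: (disj s); rewrite ?kI ?sC ?ib.
Qed.

(** An unfilled pair extends to a maximal clique and a maximal stable set; a common vertex would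
    fill it, so these are disjoint and equal [(C, S)]. *)
Lemma almost_CIS_lone_pair e : symmetric e -> irreflexive e ->
  almost_CIS e -> exists C S, lone_pair e (compl_rel e) setT C S.
Proof.
move=> se ie [C [S [mC mS CS0 un]]].
have ab := compl_antipodal se ie; have ba := antipodalC ab.
have /(maximal_cliqueP _ ab)[cC C_max] := mC.
have := mS; rewrite (maximal_stableE _ ab) => /(maximal_cliqueP _ ba)[cS S_max].
exists C, S; split=> // [v _ [Cv Sv]|K I _ _ cK cI nf].
  by move/setP/(_ v): CS0; rewrite !inE C_max ?S_max.
have [C' mC' KC'] : {C' | maxset (is_clique e) C' & K \subset C'}.
  by apply: maxset_exists; apply/(is_cliqueP _ ab).
have [S' mS' IS'] : {S' | maxset (is_stable e) S' & I \subset S'}.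
  by apply: maxset_exists; apply/is_stableP.
have /(maximal_cliqueP _ ab)[cC' _] := mC'.
have cS' : avoids e S' by case/maxsetP: mS' => /is_stableP.
suff: C' :&: S' = set0 by case/un=> // <- <-.
apply/setP=> v; rewrite !inE; apply/negP=> /andP[vC' vS']; apply: (nf v) => //.
split=> u uK; [apply: cC'|apply: cS'] => //; by [apply: (subsetP KC')|apply: (subsetP IS')].
Qed.

Lemma almost_CIS_split e : symmetric e -> irreflexive e ->
  almost_CIS e -> split_graph e.
Proof.
move=> se ie /(almost_CIS_lone_pair se ie)[C [S lp]].
have ab := compl_antipodal se ie; case: (lp) => _ cC cS _ _.
exists C, S; split.
- exact/(is_cliqueP _ ab).
- exact/is_stableP.
- by apply/eqP; rewrite -subTset; apply: (lone_pair_cover (n := #|T|.+1) _ ab lp); rewrite cardsT.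
apply/setP=> v; rewrite !inE; apply/negP=> /andP[vC].
exact: (lone_pair_disjoint lp).
Qed.

(* Adjacent simplicial vertices are twins, so a simplicial vertex of the
   complement non-adjacent to one of them must be that vertex itself. *)
Lemma simplicial_stable a b : antipodal a b -> edge_simplicial b ->
  (forall v, simplicial b v -> ~ simplicial a v) ->
  forall w z, simplicial b w -> simplicial b z -> ~~ a w z.
Proof.
move=> ab; case: (ab) => sa sb ia ib dab.
move/(edge_simplicialP (antipodalC ab)) => es noboth w z sw sz.
apply/negP=> awz; apply: (noboth w sw).
have wz : w != z by apply: contraTneq awz => ->; rewrite ia.
suff dom u : u != w -> a w u.
  apply: (nbhd_in_clique_simplicial (K := set0) sa) => [x y|u uw]; rewrite ?inE //.
  by rewrite dom.
move=> uw; rewrite dab 1?eq_sym //; apply/negP=> /es[y [sy ayw ayu]].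
have yw : y != w by apply/eqP=> E; apply: (noboth w); rewrite -?E // E.
have byw : b y w by rewrite -[b y w]negbK -dab.
have ayz : a y z by apply: contraT => nayz; move: (sy w z ayw nayz); rewrite awz.
have byz : ~~ b y z by rewrite -dab //; apply: contraTneq ayz => ->; rewrite ia.
move: byw; apply/negP; apply: (sz y w); first by rewrite sb.
by rewrite sb -dab.
Qed.

(** An isolated vertex is simplicial, so [u] lies on an edge; the centre of a simplicial clique
    containing that edge differs from [u]. *)
Lemma non_isolated a b u : antipodal a b -> edge_simplicial a -> ~ simplicial b u ->
  exists2 w, simplicial b w & a u w.
Proof.
move=> ab es nsu; case: (ab) => sa sb ia ib dab.
case: (boolP [exists v, a u v]) => [/existsP[v auv]|/existsPn nu].
  have [w [sw wu _]] := (edge_simplicialP ab).1 es u v auv.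
  exists w => //; rewrite dab 1?sb //; apply/eqP=> E; apply: nsu; by rewrite E.
case: nsu; apply: (nbhd_in_clique_simplicial (K := set0) sb) => [x y|v vu].
  by rewrite inE.
by rewrite -dab 1?eq_sym // (negPf (nu v)).
Qed.

Lemma cap_edge_simplicial_split e : symmetric e -> irreflexive e ->
  cap_edge_simplicial e -> split_graph e.
Proof.
move=> se ie [es es'].
have ab := compl_antipodal se ie; have ba := antipodalC ab.
case: (ab); set b := compl_rel e => sa sb ia ib dab.
pose A := [set v | is_clique e (closed_nbhd e v)].
pose B := [set v | is_clique b (closed_nbhd b v)].
have inA v : reflect (simplicial b v) (v \in A) by rewrite inE; apply: simplicialP.
have inB v : reflect (simplicial e v) (v \in B) by rewrite inE; apply: simplicialP.
case: (set_0Vmem (B :&: A)) => [AB0|[v /setIP[/inB vB /inA vA]]].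
  have noboth v : simplicial b v -> ~ simplicial e v.
    by move=> /inA vA /inB vB; move/setP/(_ v): AB0; rewrite inE vA vB inE.
  exists B, A; split=> //.
  - apply/(is_cliqueP _ ab) => x y /inB xB /inB yB.
    by apply: (simplicial_stable ba es) => // v vB vA; apply: (noboth v).
  - by apply/is_stableP=> x y /inA xA /inA yA; apply: (simplicial_stable ab es').
  apply/setP=> u; rewrite in_setT in_setU; apply/norP=> -[/inB uB /inA uA].
  have [w wA euw] := non_isolated ab es uA.
  have [c cB] := non_isolated ba es' uB; rewrite -/b => buc.
  have wc : w != c by apply/eqP=> E; apply: (noboth w); rewrite // E.
  have uc : u != c by apply: contraTneq buc => ->; rewrite ib.
  have uw : u != w by apply: contraTneq euw => ->; rewrite ia.
  (* Adjacency of [w] and [c] would make [u] and [c] adjacent, [w] being simplicial; non-adjacency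
     would make [u] and [w] non-adjacent, [c] being simplicial in the complement. *)
  case: (boolP (e w c)) => [ewc|newc].
    have : ~~ b u c by apply: wA; rewrite -dab // 1?eq_sym // sa.
    by rewrite buc.
  have : ~~ e u w by apply: cB; rewrite sa // dab // buc.
  by rewrite euw.
exists (closed_nbhd e v), (~: closed_nbhd e v); split; rewrite ?setUCr ?setICr //.
  exact/(simplicialP _ ab).
apply/is_stableP=> x y; rewrite !in_setC !(in_closed_nbhd _ _ ab) !negbK -/b => bvx bvy.
have nonadj z : b v z -> ~~ e v z.
  by move=> bvz; rewrite dab ?bvz //; apply: contraTneq bvz => ->; rewrite ib.
by apply: vB; apply: nonadj.
Qed.

End SplitGraphs.

Theorem theorem28 (T : finType) (e : rel T)
  (e_sym : symmetric e) (e_irr : irreflexive e) :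
  split_graph e <-> (almost_CIS e \/ cap_edge_simplicial e).
Proof.
split; first exact: split_dichotomy.
by case; [apply: almost_CIS_split|apply: cap_edge_simplicial_split].
Qed.
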